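(* Let $\mathbb{F}$ be a finite field, $\mathcal{P}\subseteq\mathbb{F}^2$ a non-empty point set with $|\mathcal{P}|=n$, and $\mathcal{F}\in\mathbb{F}^{\mathcal{P}}$ a table of interpolation values. If $\mathcal{P}$ is a semi-grid, then the algorithm $\mathsf{BivariateInterp}$ described in the context has quasi-linear complexity in the input size $|\mathcal{P}|$. Furthermore, since its output polynomial $\hat f$ has $\deg_X\hat f<n_X$ and $\deg_Y\hat f<\nu_Y$, where $n_X=n_X(\mathcal{P})$ and $\nu_Y=\nu_Y(\mathcal{P})$, the $n_X\nu_Y$-dimensional $\mathbb{F}$-vector space of polynomials satisfying these degree restrictions is in bijection with the $n$-dimensional choice of values $\mathcal{F}$. Hence $\mathsf{BivariateInterp}$ returns the unique polynomial $\hat f\in\mathbb{F}[X,Y]$ which satisfies these degree bounds and interpolates the values, i.e. $\hat f(\alpha,\beta)=\mathcal{F}[\alpha,\beta]$ for all $(\alpha,\beta)\in\mathcal{P}$. (This is in contrast to the case where $\mathcal{P}$ is not a semi-grid.)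
   Context: For $\mathcal{P}\subseteq\mathbb{F}^2$: $\mathcal{X}(\mathcal{P})=\{\alpha\in\mathbb{F}\mid\exists\beta\in\mathbb{F}:(\alpha,\beta)\in\mathcal{P}\}$, $n_X(\mathcal{P})=|\mathcal{X}(\mathcal{P})|$; for $\alpha\in\mathbb{F}$, $\mathcal{Y}_\alpha(\mathcal{P})=\{\beta\in\mathbb{F}\mid(\alpha,\beta)\in\mathcal{P}\}$; $\nu_Y(\mathcal{P})=\max_{\alpha\in\mathcal{X}(\mathcal{P})}|\mathcal{Y}_\alpha(\mathcal{P})|$. $\mathcal{P}$ is a semi-grid if $|\mathcal{Y}_\alpha(\mathcal{P})|\in\{0,\nu_Y(\mathcal{P})\}$ for each $\alpha\in\mathbb{F}$. For finite $\mathcal{A}$, an element $T\in\mathcal{B}^{\mathcal{A}}$ is a lookup table with stored values $T[a]\in\mathcal{B}$. A balanced partition tree of $\mathcal{S}\subseteq\mathbb{F}$ is a binary tree whose nodes are subsets of $\mathcal{S}$, with root $\mathcal{S}$, whose leaves are singletons, and in which each internal node is the disjoint union of its two children, whose cardinalities differ by at most $1$. For such a tree $\mathcal{T}$, $\mathcal{T}[\mathcal{N}]$ denotes the set of the two children of the node $\mathcal{N}$. Classical univariate subroutines ($\mathsf{M}(n)\in\tilde{O}(n)$ is the cost of multiplying two univariate polynomials over $\mathbb{F}$ of degree at most $n$): - $\mathsf{UnivariateMPE}(h,\mathcal{S})$, for $h\in\mathbb{F}[Z]$, $\mathcal{S}\subseteq\mathbb{F}$, outputs $(h(\alpha))_{\alpha\in\mathcal{S}}$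 in $O(\mathsf{M}(\deg h+|\mathcal{S}|)\log(\deg h+|\mathcal{S}|))$ operations. - $\mathsf{UnivariateInterp}_Y(\mathcal{S},\mathcal{F})$, for $\mathcal{F}\in\mathbb{F}^{\mathcal{S}}$, outputs the unique $f\in\mathbb{F}[Y]$ with $\deg f<|\mathcal{S}|$ and $f(\alpha)=\mathcal{F}[\alpha]$ for all $\alpha\in\mathcal{S}$, in $O(\mathsf{M}(|\mathcal{S}|)\log|\mathcal{S}|)$ operations. - $\mathsf{TreeVanish}_X(\mathcal{T})$, for a balanced partition tree $\mathcal{T}$ of $\mathcal{S}$, outputs the table $\big(\prod_{\alpha\in\mathcal{N}}(X-\alpha)\big)_{\mathcal{N}\in\mathcal{T}}$ in $O(\mathsf{M}(|\mathcal{S}|)\log|\mathcal{S}|)$ operations. Subroutine $\mathsf{Combine}(\mathcal{S},\mathcal{V},\mathcal{T},\mathcal{U})$, where $\mathcal{S}\subseteq\mathbb{F}$ is non-empty, $\mathcal{V}\in\mathbb{F}[Y]^{\mathcal{S}}$, $\mathcal{T}$ is a balanced partition tree with $\mathcal{S}$ as a node, and $\mathcal{U}=\mathsf{TreeVanish}_X(\mathcal{T})$: if $\mathcal{S}=\{\alpha\}$, return $\mathcal{V}[\alpha]$. Otherwise let $\{\mathcal{S}_1,\mathcal{S}_2\}=\mathcal{T}[\mathcal{S}]$; for $k=1,2$ let $\mathcal{V}_k=(\mathcal{V}[\alpha])_{\alpha\in\mathcal{S}_k}$ and compute recursively $\hat f_k=\mathsf{Combine}(\mathcal{S}_k,\mathcal{V}_k,\mathcal{T},\mathcal{U})$;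 return $\hat f_1\,\mathcal{U}[\mathcal{S}_2]+\hat f_2\,\mathcal{U}[\mathcal{S}_1]$. Algorithm $\mathsf{BivariateInterp}$. Input: $\mathcal{P}\subseteq\mathbb{F}^2$ non-empty and $\mathcal{F}\in\mathbb{F}^{\mathcal{P}}$. 1. $\mathcal{X}\leftarrow\mathcal{X}(\mathcal{P})$. 2. For each $\alpha\in\mathcal{X}$: $\mathcal{Y}_\alpha\leftarrow\mathcal{Y}_\alpha(\mathcal{P})$, $\mathcal{F}_\alpha\leftarrow(\mathcal{F}[\alpha,\beta])_{\beta\in\mathcal{Y}_\alpha}$, $\hat f_\alpha\leftarrow\mathsf{UnivariateInterp}_Y(\mathcal{Y}_\alpha,\mathcal{F}_\alpha)\in\mathbb{F}[Y]$. 3. $\mathcal{T}\leftarrow$ a balanced partition tree of $\mathcal{X}$; $\mathcal{U}\leftarrow\mathsf{TreeVanish}_X(\mathcal{T})$. 4. $h\leftarrow$ the formal derivative of $\mathcal{U}[\mathcal{X}]\in\mathbb{F}[X]$; $\mathcal{R}\leftarrow\mathsf{UnivariateMPE}(h,\mathcal{X})$. 5. $\mathcal{V}\leftarrow(\hat f_\alpha/\mathcal{R}[\alpha])_{\alpha\in\mathcal{X}}\in\mathbb{F}[Y]^{\mathcal{X}}$. 6. Return $\mathsf{Combine}(\mathcal{X},\mathcal{V},\mathcal{T},\mathcal{U})$. Its output is $$\hat f=\sum_{\alpha\in\mathcal{X}}\prod_{\alpha'\in\mathcal{X}\setminus\{\alpha\}}\frac{X-\alpha'}{\alpha-\alpha'}\sum_{\beta\in\mathcal{Y}_\alpha}\mathcal{F}[\alpha,\beta]\prod_{\beta'\in\mathcal{Y}_\alpha\setminus\{\beta\}}\frac{Y-\beta'}{\beta-\beta'}.$$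 Complexity counts basic arithmetic operations in $\mathbb{F}$ on an algebraic RAM model (table retrieval and insertion cost $O(1)$). Quasi-linear in $N$ means $\tilde{O}(N)$, where $\tilde{O}(h)=\bigcup_{c\ge0}O(h\log^c h)$. *)

(* Defs.v *)
From HB Require Import structures.
From mathcomp Require Import all_boot all_order all_algebra.
From mathcomp Require Import finmap.

Set Implicit Arguments.
Unset Strict Implicit.
Unset Printing Implicit Defensive.

Import GRing.Theory.
Local Open Scope fset_scope.
Local Open Scope fmap_scope.
Local Open Scope ring_scope.

(* Conventions.  Finite subsets of a field are finsets [{fset F}].  An element
   of [B ^ A] is [{ffun A -> B}] when its domain matters and [{fmap K -> B}]
   when it is a lookup table handled by a program; [FinMap] goes from the
   former to the latter.  [F[X, Y]] is [{poly {poly F}}] with the conventions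
   of [polyXY]: X is the outer variable, coefficients lie in [F[Y]], [size f]
   and [sizeY f] are one plus the X- and Y-degree (0 for f = 0), and
   [f.[a, b]] evaluates at X = a, Y = b. *)

(* The base-2 integer logarithm stands for log; the O-classes are the same. *)
Definition log (n : nat) : nat := trunc_log 2 n.

Definition bigO (f g : nat -> nat) : Prop :=
  exists C n0 : nat, forall n : nat, (n0 <= n)%N -> (f n <= C * g n)%N.

Definition softO (f h : nat -> nat) : Prop :=
  exists c : nat, bigO f (fun n => h n * log (h n) ^ c)%N.

Definition quasi_linear (f : nat -> nat) : Prop := softO f id.

Variant arith_op := Add | Sub | Mul | Div.

Definition arith_eval (F : fieldType) (o : arith_op) (x y : F) : F :=
  match o with
  | Add => x + y
  | Sub => x - y
  | Mul => x * y
  | Div => x / y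
  end.

(* Programs for an algebraic RAM.  [Arith] performs one field operation and
   continues with its result; [Access] is the unit charge of one retrieval
   from, or insertion into, a table or a set.  The programs below combine field
   elements through [Arith] only; reindexing coefficients ([Poly], [swapXY],
   [size]) is free.  The types do not enforce this. *)
Inductive prog (F A : Type) : Type :=
| Ret of A
| Arith of arith_op & F & F & (F -> prog F A)
| Access of prog F A.

Arguments Ret {F A} _.
Arguments Access {F A} _.

Fixpoint run (F : fieldType) (A : Type) (m : prog F A) : A :=
  match m with
  | Ret a => a
  | Arith o x y k => run (k (arith_eval o x y))
  | Access k => run k
  end.

Fixpoint cost (F : fieldType) (A : Type) (m : prog F A) : nat :=
  match m with
  | Ret _ => 0
  | Arith o x y k => (cost (k (arith_eval o x y))).+1
  | Access k => (cost k).+1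
  end.

Fixpoint bind (F A B : Type) (m : prog F A) (f : A -> prog F B) : prog F B :=
  match m with
  | Ret a => f a
  | Arith o x y k => Arith o x y (fun z => bind (k z) f)
  | Access k => Access (bind k f)
  end.

Notation "'let!' x ':=' m 'in' f" := (bind m (fun x => f))
  (at level 200, x name, m at level 100, f at level 200,
   format "'[v' 'let!'  x  ':='  m  'in' '/' f ']'").

Section Primitives.
Variable F : Type.

Definition arith (o : arith_op) (x y : F) : prog F F := Arith o x y Ret.

Definition get (K : choiceType) (B : Type) (d : B) (T : {fmap K -> B}) (k : K) :
  prog F B := Access (Ret (odflt d T.[? k])).

Definition put (K : choiceType) (B : Type) (T : {fmap K -> B}) (k : K) (b : B) :
  prog F {fmap K -> B} := Access (Ret T.[k <- b]).

Definition insert (K : choiceType) (S : {fset K}) (k : K) : prog F {fset K} :=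
  Access (Ret (k |` S)).

Definition accesses (n : nat) : prog F unit := iter n Access (Ret tt).

Fixpoint foldM (I A : Type) (f : A -> I -> prog F A) (a : A) (s : seq I) :
  prog F A :=
  if s is i :: s' then let! a' := f a i in foldM f a' s' else Ret a.

Fixpoint mapM (I A : Type) (f : I -> prog F A) (s : seq I) : prog F (seq A) :=
  if s is i :: s' then
    let! a := f i in
    let! r := mapM f s' in
    Ret (a :: r)
  else Ret [::].

(* The table (e k) for k in S. *)
Definition table (K : choiceType) (B : Type) (S : {fset K})
    (e : K -> prog F B) : prog F {fmap K -> B} :=
  foldM (fun T k => let! b := e k in put T k b) [fmap] (enum_fset S).

End Primitives.

Arguments get {F K B} d T k.
Arguments accesses {F} n.

Section PointSets.
Variables (F : finFieldType) (P : {fset F * F}).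

Definition projX : {fset F} := [fset p.1 | p in P].

Definition sliceY (a : F) : {fset F} := [fset p.2 | p in P & p.1 == a].

Definition nX : nat := #|` projX |.

Definition nuY : nat := \max_(a <- projX) #|` sliceY a |.

Definition semi_grid : Prop :=
  forall a : F, #|` sliceY a | = 0%N \/ #|` sliceY a | = nuY.

End PointSets.

(* Nodes are determined by their leaves, so only the leaves are stored; the
   subtree t represents the node [tree_root t]. *)
Inductive ptree (F : Type) : Type :=
| Leaf of F
| Node of ptree F & ptree F.

Section Trees.
Variable F : choiceType.

Fixpoint tree_root (t : ptree F) : {fset F} :=
  match t with
  | Leaf a => [fset a]
  | Node l r => tree_root l `|` tree_root r
  end.

Fixpoint nodes (t : ptree F) : {fset {fset F}} :=
  match t with
  | Leaf a => [fset [fset a]]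
  | Node l r => tree_root t |` (nodes l `|` nodes r)
  end.

Fixpoint balanced (t : ptree F) : bool :=
  match t with
  | Leaf _ => true
  | Node l r =>
    [&& fdisjoint (tree_root l) (tree_root r),
        (#|` tree_root l | <= #|` tree_root r |.+1)%N,
        (#|` tree_root r | <= #|` tree_root l |.+1)%N,
        balanced l & balanced r]
  end.

Definition balanced_partition_tree (S : {fset F}) (t : ptree F) : Prop :=
  tree_root t = S /\ balanced t.

End Trees.

Definition vanishing (F : fieldType) (N : {fset F}) : {poly F} :=
  \prod_(a <- N) ('X - a%:P).

(* [partition_tree] resolves the choice of "a balanced partition tree". *)
Record subroutines := Subroutines {
  PolyMul : forall F : finFieldType, {poly F} -> {poly F} -> prog F {poly F};
  UnivariateMPE : forall F : finFieldType,
    {poly F} -> {fset F} -> prog F {fmap F -> F};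
  UnivariateInterp : forall F : finFieldType,
    {fset F} -> {fmap F -> F} -> prog F {poly F};
  TreeVanish : forall F : finFieldType,
    ptree F -> prog F {fmap {fset F} -> {poly F}};
  partition_tree : forall F : finFieldType, {fset F} -> ptree F
}.

(* Each cost bound is a single function of the size, uniform in the field. *)
Record subroutines_spec (M : nat -> nat) (sub : subroutines) : Prop :=
  SubroutinesSpec {
  PolyMul_run : forall (F : finFieldType) (p q : {poly F}),
    run (PolyMul sub p q) = p * q;
  PolyMul_cost : forall (F : finFieldType) (n : nat) (p q : {poly F}),
    (size p <= n.+1)%N -> (size q <= n.+1)%N ->
    (cost (PolyMul sub p q) <= M n)%N;
  UnivariateMPE_run : forall (F : finFieldType) (h : {poly F}) (S : {fset F}),
    run (UnivariateMPE sub h S) = [fmap a : S => h.[val a]];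
  UnivariateMPE_cost : exists2 W : nat -> nat,
    bigO W (fun n => M n * log n)%N &
    forall (F : finFieldType) (h : {poly F}) (S : {fset F}),
      (cost (UnivariateMPE sub h S) <= W ((size h).-1 + #|` S |))%N;
  UnivariateInterp_run : forall (F : finFieldType) (S : {fset F})
      (V : {ffun S -> F}),
    let f := run (UnivariateInterp sub S (FinMap V)) in
    (size f <= #|` S |)%N /\ forall a : S, f.[val a] = V a;
  UnivariateInterp_cost : exists2 W : nat -> nat,
    bigO W (fun n => M n * log n)%N &
    forall (F : finFieldType) (S : {fset F}) (V : {ffun S -> F}),
      (cost (UnivariateInterp sub S (FinMap V)) <= W #|` S |)%N;
  TreeVanish_run : forall (F : finFieldType) (S : {fset F}) (t : ptree F),
    balanced_partition_tree S t ->
    run (TreeVanish sub t) = [fmap N : nodes t => vanishing (val N)];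
  TreeVanish_cost : exists2 W : nat -> nat,
    bigO W (fun n => M n * log n)%N &
    forall (F : finFieldType) (S : {fset F}) (t : ptree F),
      balanced_partition_tree S t ->
      (cost (TreeVanish sub t) <= W #|` S |)%N;
  partition_treeP : forall (F : finFieldType) (S : {fset F}),
    S != fset0 -> balanced_partition_tree S (partition_tree sub S)
}.

Section Algorithm.
Variables (sub : subroutines) (F : finFieldType).

Definition poly_add (p q : {poly F}) : prog F {poly F} :=
  let! s := mapM (fun i => arith Add p`_i q`_i)
                 (iota 0 (maxn (size p) (size q))) in
  Ret (Poly s).

Definition poly_div_scalar (p : {poly F}) (c : F) : prog F {poly F} :=
  let! s := mapM (fun x => arith Div x c) p in
  Ret (Poly s).

(* c runs through the exponents, as elements of F. *)
Fixpoint deriv_coefs (c : F) (s : seq F) : prog F (seq F) :=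
  if s is x :: s' then
    let! y := arith Mul c x in
    let! c' := arith Add c 1 in
    let! r := deriv_coefs c' s' in
    Ret (y :: r)
  else Ret [::].

Definition poly_deriv (p : {poly F}) : prog F {poly F} :=
  let! s := deriv_coefs 1 (behead p) in
  Ret (Poly s).

Definition bipoly_add (f g : {poly {poly F}}) : prog F {poly {poly F}} :=
  let! s := mapM (fun i => poly_add f`_i g`_i)
                 (iota 0 (maxn (size f) (size g))) in
  Ret (Poly s).

(* f * u for u in F[X], as one product in F[X] for each power of Y: the
   coefficient of Y^j in f is [(swapXY f)`_j]. *)
Definition bipoly_mulX (f : {poly {poly F}}) (u : {poly F}) :
    prog F {poly {poly F}} :=
  let! s := mapM (fun j => PolyMul sub (swapXY f)`_j u) (iota 0 (sizeY f)) in
  Ret (swapXY (Poly s)).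

(* Combine(S, V, T, U): the subtree t stands for the node S = tree_root t of T
   together with what lies below it.  The unit access in the second case is
   the retrieval of the children T[S]. *)
Fixpoint Combine (t : ptree F) (V : {fmap F -> {poly F}})
    (U : {fmap {fset F} -> {poly F}}) : prog F {poly {poly F}} :=
  match t with
  | Leaf a =>
    let! v := get 0 V a in
    Ret v%:P
  | Node t1 t2 =>
    let! _ := accesses 1 in
    let! V1 := table (tree_root t1) (get 0 V) in
    let! V2 := table (tree_root t2) (get 0 V) in
    let! f1 := Combine t1 V1 U in
    let! f2 := Combine t2 V2 U in
    let! u1 := get 0 U (tree_root t1) in
    let! u2 := get 0 U (tree_root t2) in
    let! g1 := bipoly_mulX f1 u2 in
    let! g2 := bipoly_mulX f2 u1 in
    bipoly_add g1 g2
  end.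

Definition compute_projX (P : {fset F * F}) : prog F {fset F} :=
  foldM (fun X p => insert F X p.1) fset0 (enum_fset P).

(* All the slices Y_a at once, in a single traversal of P. *)
Definition compute_slices (P : {fset F * F}) : prog F {fmap F -> {fset F}} :=
  foldM (fun (Y : {fmap F -> {fset F}}) p =>
           let! S := get fset0 Y p.1 in
           let! S' := insert F S p.2 in
           put F Y p.1 S')
        [fmap] (enum_fset P).

(* Writing T down inserts every element of every node. *)
Definition compute_tree (S : {fset F}) : prog F (ptree F) :=
  let T := partition_tree sub S in
  let! _ := accesses (\sum_(N <- nodes T) #|` N |) in
  Ret T.

Definition BivariateInterp (P : {fset F * F}) (Fv : {ffun P -> F}) :
    prog F {poly {poly F}} :=
  let! X := compute_projX P in
  let! Y := compute_slices P in
  let! fhat := table X (fun a =>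
    let! Ya := get fset0 Y a in
    let! Fa := table Ya (fun b => get 0 (FinMap Fv) (a, b)) in
    UnivariateInterp sub Ya Fa) in
  let! T := compute_tree X in
  let! U := TreeVanish sub T in
  let! u := get 0 U X in
  let! h := poly_deriv u in
  let! R := UnivariateMPE sub h X in
  let! V := table X (fun a =>
    let! p := get 0 fhat a in
    let! c := get 0 R a in
    poly_div_scalar p c) in
  Combine T V U.

End Algorithm.

(* The canonical scalars of {poly {poly F}} are {poly F}; the F-vector space of
   those f with deg_X f < m and deg_Y f < n is set up on a subtype. *)
Section BoundedDegree.
Variables (F : fieldType) (m n : nat).

Definition deg_bounded (f : {poly {poly F}}) : bool :=
  (size f <= m)%N && (sizeY f <= n)%N.

Record bipoly := BiPoly { bipoly_val :> {poly {poly F}};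
                          bipolyP : deg_bounded bipoly_val }.

HB.instance Definition _ := [isSub for bipoly_val].
HB.instance Definition _ := [Choice of bipoly by <:].

Lemma deg_boundedP (f : {poly {poly F}}) :
  reflect (forall i j, (m <= i)%N || (n <= j)%N -> f`_i`_j = 0)
          (deg_bounded f).
Proof.
apply: (iffP andP) => [[sX sY] i j /orP[le_i|le_j]|f0].
- by rewrite (nth_default _ (leq_trans sX le_i)) coef0.
- have [lt_i|ge_i] := ltnP i (size f); last by rewrite (nth_default _ ge_i) coef0.
  rewrite nth_default //; apply: leq_trans le_j; apply: leq_trans sY.
  exact: (@leq_bigmax _ (fun i : 'I_(size f) => size f`_i) (Ordinal lt_i)).
- split; first by apply/leq_sizeP => i le_i; apply/polyP => j;
    rewrite coef0 f0 ?le_i.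
  apply/bigmax_leqP => i _; apply/leq_sizeP => j le_j.
  by rewrite f0 ?le_j ?orbT.
Qed.

Definition bipoly_mx (f : bipoly) : 'M[F]_(m, n) := \matrix_(i, j) f`_i`_j.

Definition mx_poly2 (A : 'M[F]_(m, n)) : {poly {poly F}} :=
  \poly_(i < m) \poly_(j < n)
    (if insub i is Some i' then if insub j is Some j' then A i' j' else 0
     else 0).

Lemma mx_poly2_bounded A : deg_bounded (mx_poly2 A).
Proof.
apply/deg_boundedP => i j; rewrite coef_poly; case: ltnP => [_|]; last by rewrite coef0.
by rewrite coef_poly /= => le_j; rewrite ltnNge le_j.
Qed.

Definition mx_bipoly A : bipoly := BiPoly (mx_poly2_bounded A).

Lemma bipoly_mxK : cancel bipoly_mx mx_bipoly.
Proof.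
move=> f; apply: val_inj; apply/polyP => i; apply/polyP => j /=.
have /deg_boundedP f0 := bipolyP f.
rewrite coef_poly; case: ltnP => [lt_i|ge_i]; last by rewrite coef0 f0 ?ge_i.
rewrite coef_poly; case: ltnP => [lt_j|ge_j]; last by rewrite f0 ?ge_j ?orbT.
by rewrite !insubT mxE.
Qed.

Lemma mx_bipolyK : cancel mx_bipoly bipoly_mx.
Proof.
move=> A; apply/matrixP => i j; rewrite mxE /= coef_poly ltn_ord coef_poly.
by rewrite ltn_ord !valK.
Qed.

Fact deg_bounded_zmod : zmod_closed deg_bounded.
Proof.
split=> [|f g /deg_boundedP f0 /deg_boundedP g0]; apply/deg_boundedP => i j b.
  by rewrite !coef0.
by rewrite !coefB f0 // g0 // subrr.
Qed.

HB.instance Definition _ :=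
  GRing.isZmodClosed.Build {poly {poly F}} deg_bounded deg_bounded_zmod.
HB.instance Definition _ := [SubChoice_isSubZmodule of bipoly by <:].

Fact scale_bounded (c : F) (f : bipoly) : deg_bounded (c%:P *: bipoly_val f).
Proof.
have /deg_boundedP f0 := bipolyP f.
by apply/deg_boundedP => i j b; rewrite coefZ coefCM f0 // mulr0.
Qed.

Definition bipoly_scale (c : F) (f : bipoly) : bipoly :=
  BiPoly (scale_bounded c f).

Fact bipoly_scaleA a b f :
  bipoly_scale a (bipoly_scale b f) = bipoly_scale (a * b) f.
Proof. by apply: val_inj; rewrite /= scalerA polyCM. Qed.

Fact bipoly_scale1 : left_id 1 bipoly_scale.
Proof. by move=> f; apply: val_inj; rewrite /= scale1r. Qed.

Fact bipoly_scaleDr : right_distributive bipoly_scale +%R.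
Proof. by move=> a f g; apply: val_inj; rewrite /= scalerDr. Qed.

Fact bipoly_scaleDl f : {morph bipoly_scale^~ f : a b / a + b}.
Proof. by move=> a b; apply: val_inj; rewrite /= polyCD scalerDl. Qed.

HB.instance Definition _ := GRing.Zmodule_isLmodule.Build F bipoly
  bipoly_scaleA bipoly_scale1 bipoly_scaleDr bipoly_scaleDl.

Fact bipoly_vect_axiom : Vector.axiom (m * n) bipoly.
Proof.
exists (mxvec \o bipoly_mx).
  move=> c f g; rewrite /= -linearP; congr mxvec.
  by apply/matrixP => i j; rewrite !mxE /= coefD coefZ coefD coefCM.
by exists (mx_bipoly \o vec_mx) => [f|v] /=;
  rewrite ?mxvecK ?bipoly_mxK // mx_bipolyK vec_mxK.
Qed.

HB.instance Definition _ :=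
  Lmodule_hasFinDim.Build F bipoly bipoly_vect_axiom.

End BoundedDegree.

Arguments bipoly F m n : clear implicits.

Definition interpolates (F : finFieldType) (P : {fset F * F})
    (Fv : {ffun P -> F}) (f : {poly {poly F}}) : Prop :=
  forall p : P, f.[(val p).1, (val p).2] = Fv p.

(* Main.v *)
Require Import Defs.
From HB Require Import structures.
From mathcomp Require Import all_boot all_order all_algebra.
From mathcomp Require Import finmap zify.

Set Implicit Arguments.
Unset Strict Implicit.
Unset Printing Implicit Defensive.

Import GRing.Theory.
Local Open Scope fset_scope.
Local Open Scope ring_scope.

(** For each column [a], let [f_a] in [F[Y]] interpolate the values of the column.
    The polynomials [f_a / u'(a)], with [u] the vanishing polynomial of the
    abscissae, are combined along the tree into

      sum_a (f_a / u'(a)) * prod_(c != a) (X - c),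

    because at each node this expression splits according to the child that
    contains [a], the other child contributing its vanishing polynomial as a
    common factor ([lagrange_combU], [run_Combine]). Since [u'(a)] is the product
    of the [a - c] ([deriv_vanishing]), the root returns the Lagrange interpolant
    of the [f_a] over [F[Y]] ([run_BivariateInterp]), whence the degree bounds and
    the interpolation property.

    Two interpolants within the degree bounds have a difference [g] that vanishes
    on [P]. On a semi-grid each [g(a, Y)] has [nuY] roots and degree below [nuY], so
    it is zero; then [g] has [nX] roots in the
    domain [F[Y]] and is zero as well ([bounded_interpolant_eq0]). Thus the output
    is the only interpolant within the bounds, and evaluation on [P] inverts the
    algorithm ([interp_bipoly_bij]). Without the semi-grid condition a column with
    fewer than [nuY] points yields a nonzero polynomial within the bounds that
    vanishes on [P] ([vanishing_bipoly]).

    For the cost, a balanced tree with [s] leaves has depth at most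
    [1 + log s], so the sizes of its nodes add up to [O(s log s)]
    ([tree_weight_le]); a node of size [s] costs [Combine] [O(nuY)] products of
    degree at most [s] ([cost_Combine]). On a semi-grid [nX * nuY = #|P|], and
    everything adds up to a quasi-linear bound ([cost_BivariateInterp_le]). *)

(** * Values and costs of the elementary programs *)

Section Programs.
Local Open Scope fmap_scope.
Variable F : fieldType.

Lemma run_bind (A B : Type) (m : prog F A) (f : A -> prog F B) :
  run (bind m f) = run (f (run m)).
Proof. by elim: m => //= o x y k IH; rewrite IH. Qed.

Lemma cost_bind (A B : Type) (m : prog F A) (f : A -> prog F B) :
  cost (bind m f) = (cost m + cost (f (run m)))%N.
Proof. by elim: m => //= [o x y k IH|m IH]; rewrite IH. Qed.

Lemma cost_accesses n : cost (@accesses F n) = n.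
Proof. by elim: n => //= n ->. Qed.

Lemma run_mapM (I A : Type) (f : I -> prog F A) s :
  run (mapM f s) = map (fun i => run (f i)) s.
Proof. by elim: s => //= i s IH; rewrite !run_bind /= IH. Qed.

Lemma cost_mapM (I A : Type) (f : I -> prog F A) s :
  cost (mapM f s) = (\sum_(i <- s) cost (f i))%N.
Proof.
elim: s => [|i s IH] /=; first by rewrite big_nil.
by rewrite !cost_bind IH big_cons /= addn0.
Qed.

Lemma cost_foldM_const (I A : Type) (f : A -> I -> prog F A) c :
  (forall a i, cost (f a i) = c) ->
  forall s a, cost (foldM f a s) = (c * size s)%N.
Proof.
move=> fc; elim=> [|i s IH] a /=; first by rewrite muln0.
by rewrite cost_bind fc IH mulnS.
Qed.

Lemma cost_table (K : choiceType) (B : Type) (S : {fset K}) (e : K -> prog F B) :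
  cost (table S e) = (\sum_(k <- S) (cost (e k)).+1)%N.
Proof.
rewrite /table; elim: (enum_fset S) [fmap] => [|k s IH] T /=.
  by rewrite big_nil.
by rewrite !cost_bind /= big_cons IH addn1.
Qed.

Lemma fnd_run_table (K : choiceType) (B : Type) (S : {fset K})
    (e : K -> prog F B) k :
  (run (table S e)).[? k] = if k \in S then Some (run (e k)) else None.
Proof.
rewrite /table -[k \in S]/(k \in enum_fset S).
suff H s T : (run (foldM (fun T k => let! b := e k in put F T k b) T s)).[? k]
    = if k \in s then Some (run (e k)) else T.[? k].
  by rewrite H fnd_fmap0.
elim: s T => //= i s IH T; rewrite !run_bind /= IH fnd_set inE.
by have [->|_] := eqVneq k i; case: ifP.
Qed.

Lemma run_table (K : choiceType) (B : Type) (S : {fset K}) (e : K -> prog F B) :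
  run (table S e) = FinMap [ffun k : S => run (e (val k))].
Proof.
apply/fmapP => k; rewrite fnd_run_table; case: fndP => //= kS.
by rewrite ffunE.
Qed.

End Programs.

Section PolynomialPrograms.
Variables (M : nat -> nat) (sub : subroutines).
Hypothesis subP : subroutines_spec M sub.
Variable F : finFieldType.
Implicit Types (p q u : {poly F}) (f g : {poly {poly F}}).

Lemma run_poly_add p q : run (poly_add p q) = p + q.
Proof.
rewrite run_bind run_mapM /=; apply/polyP => i; rewrite coef_Poly coefD.
have [lt_i|ge_i] := ltnP i (maxn (size p) (size q)).
  by rewrite (nth_map 0%N) ?size_iota // nth_iota.
rewrite nth_default ?size_map ?size_iota //.
by move: ge_i; rewrite geq_max => /andP[? ?]; rewrite !nth_default ?addr0.
Qed.

Lemma cost_poly_add p q : cost (poly_add p q) = maxn (size p) (size q).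
Proof.
by rewrite cost_bind cost_mapM /= addn0 big_const_seq count_predT size_iota
  iter_addn_0 mul1n.
Qed.

Lemma run_poly_div_scalar p c : run (poly_div_scalar p c) = c^-1 *: p.
Proof.
rewrite run_bind run_mapM /=; apply/polyP => i; rewrite coef_Poly coefZ.
have [lt_i|ge_i] := ltnP i (size p); first by rewrite (nth_map 0) // mulrC.
by rewrite !nth_default ?size_map // mulr0.
Qed.

Lemma cost_poly_div_scalar p c : cost (poly_div_scalar p c) = size p.
Proof.
by rewrite cost_bind cost_mapM /= addn0 big_const_seq count_predT iter_addn_0
  mul1n.
Qed.

(** [c] is the exponent that belongs to the head of [s]. *)
Lemma nth_deriv_coefs (c : F) s i :
  (run (deriv_coefs c s))`_i = (c + i%:R) * s`_i.
Proof.
elim: s c i => [|x s IH] c i /=; first by rewrite nth_nil mulr0.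
rewrite run_bind /=; case: i => [|i] /=; first by rewrite addr0.
by rewrite IH -addrA nat1r.
Qed.

Lemma run_poly_deriv p : run (poly_deriv p) = p^`().
Proof.
rewrite run_bind /=; apply/polyP => i.
by rewrite coef_Poly nth_deriv_coefs nth_behead coef_deriv nat1r mulr_natl.
Qed.

Lemma cost_poly_deriv p : cost (poly_deriv p) = ((size p).-1).*2.
Proof.
rewrite cost_bind /= addn0 -size_behead.
elim: (behead p) 1 => //= x s IH c.
by rewrite cost_bind /= addn0 IH.
Qed.

Lemma run_bipoly_add f g : run (bipoly_add f g) = f + g.
Proof.
rewrite run_bind run_mapM /=; apply/polyP => i; rewrite coef_Poly coefD.
have [lt_i|ge_i] := ltnP i (maxn (size f) (size g)).
  by rewrite (nth_map 0%N) ?size_iota // nth_iota // run_poly_add.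
rewrite nth_default ?size_map ?size_iota //.
by move: ge_i; rewrite geq_max => /andP[? ?]; rewrite !nth_default ?addr0.
Qed.

Lemma cost_bipoly_add f g m n :
    (size f <= m)%N -> (size g <= m)%N -> (sizeY f <= n)%N -> (sizeY g <= n)%N ->
  (cost (bipoly_add f g) <= m * n)%N.
Proof.
move=> fm gm fn gn; rewrite cost_bind cost_mapM /= addn0.
apply: (@leq_trans (\sum_(i <- iota 0 (maxn (size f) (size g))) n)).
  apply: leq_sum => i _; rewrite cost_poly_add geq_max.
  by rewrite !(leq_trans (max_size_coefXY _ _)).
rewrite big_const_seq count_predT size_iota iter_addn_0 mulnC.
by rewrite leq_mul // geq_max fm.
Qed.

(** Seen through [swapXY], multiplying every coefficient in [F[X]] by [u] is
    multiplication by a constant polynomial. *)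
Lemma run_bipoly_mulX f u : run (bipoly_mulX sub f u) = f * u^:P.
Proof.
rewrite run_bind run_mapM /=; apply: (can_inj (@swapXYK F)).
rewrite swapXYK rmorphM /= swapXY_map_polyC; apply/polyP => j.
rewrite coef_Poly coefMC.
have [lt_j|ge_j] := ltnP j (sizeY f).
  by rewrite (nth_map 0%N) ?size_iota // nth_iota // (PolyMul_run subP).
rewrite nth_default ?size_map ?size_iota //.
by rewrite nth_default ?mul0r // -sizeYE.
Qed.

Lemma cost_bipoly_mulX f u m n :
    (size f <= m.+1)%N -> (size u <= m.+1)%N -> (sizeY f <= n)%N ->
  (cost (bipoly_mulX sub f u) <= n * M m)%N.
Proof.
move=> fm um fn; rewrite cost_bind cost_mapM /= addn0.
apply: (@leq_trans (\sum_(i <- iota 0 (sizeY f)) M m)).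
  apply: leq_sum => j _; apply: (PolyMul_cost subP) => //.
  by rewrite (leq_trans (max_size_coefXY _ _)) // sizeYE swapXYK.
by rewrite big_const_seq count_predT size_iota iter_addn_0 mulnC leq_mul2r fn orbT.
Qed.

End PolynomialPrograms.

(** * Lagrange interpolation in X over F[Y] *)

Section LagrangeInterpolation.
Variable F : finFieldType.
Implicit Types (A B S : {fset F}) (a b : F) (V : F -> {poly F}).

Lemma perm_fsetU (K : choiceType) (A B : {fset K}) : [disjoint A & B] ->
  perm_eq (A `|` B) (enum_fset A ++ enum_fset B).
Proof.
move=> disAB; apply: uniq_perm => [||x]; rewrite ?fset_uniq //; last first.
  by rewrite mem_cat inE.
rewrite cat_uniq !fset_uniq andbT /=; apply/hasPn => x xB.
by apply: contraL xB => xA; apply: (fdisjointP disAB).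
Qed.

Lemma vanishingU A B : [disjoint A & B] ->
  vanishing (A `|` B) = vanishing A * vanishing B.
Proof. by move=> dis; rewrite /vanishing (perm_big _ (perm_fsetU dis)) big_cat. Qed.

Lemma size_vanishing S : size (vanishing S) = #|` S|.+1.
Proof. exact: size_prod_XsubC. Qed.

Lemma vanishing_neq0 S : vanishing S != 0.
Proof. by rewrite -size_poly_eq0 size_vanishing. Qed.

Lemma root_vanishing S a : root (vanishing S) a = (a \in S).
Proof. exact: root_prod_XsubC. Qed.

Lemma cardfsD1_pred S a : a \in S -> #|` S `\ a|.+1 = #|` S|.
Proof. by move=> aS; rewrite (cardfsD1 a S) aS. Qed.

(** Differentiating ('X - a) * q and evaluating at [a] leaves q.[a]: this is why
    all Lagrange denominators are values of one derivative. *)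
Lemma deriv_vanishing S a : a \in S ->
  (vanishing S)^`().[a] = (vanishing (S `\ a)).[a].
Proof.
move=> aS; rewrite /vanishing (big_fsetD1 a) //= derivM derivXsubC mul1r.
by rewrite hornerD hornerM hornerXsubC subrr mul0r addr0.
Qed.

Lemma vanishing_self_neq0 S a : (vanishing (S `\ a)).[a] != 0.
Proof. by rewrite -[_ == 0]/(root _ a) root_vanishing !inE eqxx. Qed.

(** The polynomial that the divide-and-conquer recursion computes from the table
    [V]: Lagrange interpolation over [F[Y]], with the denominators left to [V]. *)
Definition lagrange_comb V S : {poly {poly F}} :=
  \sum_(a <- S) (V a)%:P * (vanishing (S `\ a))^:P.

Lemma eq_lagrange_comb V1 V2 S : {in S, V1 =1 V2} ->
  lagrange_comb V1 S = lagrange_comb V2 S.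
Proof. by move=> eqV; apply: eq_big_seq => a aS; rewrite eqV. Qed.

(** For [a] in [A], the roots other than [a] in a disjoint union are those of
    [A `\ a] together with [B], so every term coming from [A] carries the
    factor [vanishing B], and symmetrically. *)
Lemma lagrange_combU V A B : [disjoint A & B] ->
  lagrange_comb V (A `|` B) =
  lagrange_comb V A * (vanishing B)^:P + lagrange_comb V B * (vanishing A)^:P.
Proof.
move=> dis; rewrite /lagrange_comb (perm_big _ (perm_fsetU dis)) big_cat /=.
rewrite !mulr_suml; congr (_ + _); apply: eq_big_seq => a aS.
  rewrite -mulrA -rmorphM -vanishingU.
    congr (_ * (vanishing _)^:P).
    by rewrite fsetDUl (mem_fsetD1 (fdisjointP dis _ aS)).
  exact: fdisjointWl (fsubD1set _ _) dis.
rewrite -mulrA -rmorphM -vanishingU.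
  congr (_ * (vanishing _)^:P).
  by rewrite fsetDUl fsetUC (mem_fsetD1 (fdisjointP_sym dis _ aS)).
by rewrite fdisjoint_sym (fdisjointWr (fsubD1set _ _) dis).
Qed.

Lemma lagrange_comb1 V a : lagrange_comb V [fset a] = (V a)%:P.
Proof.
rewrite /lagrange_comb big_seq_fset1 fsetDv /vanishing big_seq_fset0.
by rewrite rmorph1 mulr1.
Qed.

Lemma size_lagrange_comb V S : (size (lagrange_comb V S) <= #|` S|)%N.
Proof.
rewrite /lagrange_comb big_seq; apply: (leq_trans (size_sum _ _ _)).
apply/bigmax_leqP_seq => a _ aS; rewrite mul_polyC.
by rewrite (leq_trans (size_scale_leq _ _)) // size_map_polyC size_vanishing
  cardfsD1_pred.
Qed.

Lemma sizeY_lagrange_comb V S n : {in S, forall a, (size (V a) <= n)%N} ->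
  (sizeY (lagrange_comb V S) <= n)%N.
Proof.
move=> Vn; rewrite sizeYE /lagrange_comb raddf_sum big_seq.
apply: (leq_trans (size_sum _ _ _)); apply/bigmax_leqP_seq => a _ aS.
rewrite /= rmorphM /= swapXY_map_polyC swapXY_polyC mulrC mul_polyC.
by rewrite (leq_trans (size_scale_leq _ _)) // size_map_polyC Vn.
Qed.

Lemma horner_lagrange_comb V S a : a \in S ->
  (lagrange_comb V S).[a%:P] = (vanishing (S `\ a)).[a] *: V a.
Proof.
move=> aS; rewrite /lagrange_comb horner_sum (big_fsetD1 a) //= hornerM hornerC.
rewrite horner_map /= big_seq big1 ?addr0 => [|c]; first by rewrite mulrC mul_polyC.
rewrite !inE => /andP[ca cS]; rewrite hornerM horner_map /=.
have /rootP -> : root (vanishing (S `\ c)) a by rewrite root_vanishing !inE eq_sym ca.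
by rewrite mulr0.
Qed.

(** A nonzero polynomial has fewer roots than its size. This applies first to
    [f.[a%:P]] for each [a] in [S], with the roots [Y a], and then to [f] itself,
    with the roots [S] in the domain [F[Y]]. *)
Lemma bounded_interpolant_eq0 (f : {poly {poly F}}) S (Y : F -> {fset F}) n :
    {in S, forall a, #|` Y a| = n} ->
    (size f <= #|` S|)%N -> (sizeY f <= n)%N ->
    {in S, forall a, {in Y a, forall b, f.[a, b] = 0}} ->
  f = 0.
Proof.
move=> cardY szX szY f0; apply/eqP; apply: contraTT szX => nzf; rewrite -ltnNge.
rewrite -(size_map (@polyC F) S); apply: max_poly_roots => //.
  rewrite all_map; apply/allP => a aS /=; apply/rootP/eqP.
  apply: contraTT szY => nzfa; rewrite -ltnNge -(cardY a aS).
  apply: leq_trans (max_size_evalC f a); apply: max_poly_roots; rewrite ?fset_uniq //.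
  by apply/allP => b bY; apply/rootP; apply: f0.
by rewrite map_inj_uniq ?fset_uniq //; apply: polyC_inj.
Qed.

End LagrangeInterpolation.

(** * The output of the algorithm *)

Lemma mem_tree_root (K : choiceType) (t : ptree K) : tree_root t \in nodes t.
Proof. by case: t => [a|l r] /=; rewrite !inE eqxx. Qed.

Section Correctness.
Local Open Scope fmap_scope.
Local Open Scope ring_scope.
Variables (M : nat -> nat) (sub : subroutines).
Hypothesis subP : subroutines_spec M sub.
Variable F : finFieldType.

(** [U] tabulates the whole tree while [t] shrinks to its subtrees, so only the
    entries of [U] at nodes of [t] are constrained. *)
Lemma run_Combine (t : ptree F) (V : {fmap F -> {poly F}})
    (U : {fmap {fset F} -> {poly F}}) :
    balanced t -> {in nodes t, forall N, U.[? N] = Some (vanishing N)} ->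
  run (Combine sub t V U) =
  lagrange_comb (fun a => odflt 0 V.[? a]) (tree_root t).
Proof.
elim: t V => [a|l IHl r IHr] V /=; first by rewrite lagrange_comb1.
case/and5P=> dis _ _ ball balr UE.
have Ul : {in nodes l, forall N, U.[? N] = Some (vanishing N)}.
  by move=> N Nl; apply: UE; rewrite !inE Nl !orbT.
have Ur : {in nodes r, forall N, U.[? N] = Some (vanishing N)}.
  by move=> N Nr; apply: UE; rewrite !inE Nr !orbT.
(* A rewrite of every bind would also open those that define the products. *)
do 4!(rewrite run_bind; cbv beta); do 2!rewrite /= run_bind.
rewrite run_bipoly_add !(run_bipoly_mulX subP) IHl ?IHr //.
rewrite (Ul _ (mem_tree_root l)) (Ur _ (mem_tree_root r)) /=.
rewrite lagrange_combU //; congr (_ * _ + _ * _);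
  by apply: eq_lagrange_comb => a aS; rewrite fnd_run_table aS.
Qed.

Variable P : {fset F * F}.

Lemma mem_projX a b : (a, b) \in P -> a \in projX P.
Proof. by move=> abP; apply/imfsetP; exists (a, b). Qed.

Lemma mem_sliceY a b : (b \in sliceY P a) = ((a, b) \in P).
Proof.
apply/imfsetP/idP => /= [[[c d]]|abP]; last by exists (a, b); rewrite //= inE abP /=.
by rewrite !inE /= => /andP[cdP /eqP <-] ->.
Qed.

Lemma projXP a : reflect (exists b, (a, b) \in P) (a \in projX P).
Proof.
apply: (iffP (imfsetP _ _ _ _)) => [[[c d] cdP ->]|[b abP]]; first by exists d.
by exists (a, b).
Qed.

Lemma sliceY_eq0 a : (sliceY P a == fset0) = (a \notin projX P).
Proof.
apply/idP/idP => [/eqP sl0|].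
  by apply/projXP => -[b]; rewrite -mem_sliceY sl0 inE.
by apply: contraR => /fset0Pn[b]; rewrite mem_sliceY => /mem_projX.
Qed.

Lemma projX_neq0 : P != fset0 -> projX P != fset0.
Proof.
by case/fset0Pn=> -[a b] /mem_projX aX; apply/fset0Pn; exists a.
Qed.

Lemma leq_nuY a : a \in projX P -> (#|` sliceY P a| <= nuY P)%N.
Proof. by move=> aX; apply: (leq_bigmax_seq _ aX). Qed.

Lemma card_sliceY : semi_grid P -> {in projX P, forall a, #|` sliceY P a| = nuY P}.
Proof.
move=> sg a aX; have [/eqP|//] := sg a.
by rewrite cardfs_eq0 sliceY_eq0 aX.
Qed.

Lemma card_sum_sliceY : (\sum_(a <- projX P) #|` sliceY P a|)%N = #|` P|.
Proof.
rewrite -[RHS]sum1_size (partition_big_imfset _ (fun p : F * F => p.1)) /=.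
apply: eq_bigr => a _; rewrite sum1_count -size_filter.
rewrite -(size_map (fun p : F * F => p.2)); apply/perm_size/uniq_perm.
- exact: fset_uniq.
- rewrite map_inj_in_uniq ?filter_uniq ?fset_uniq // => -[c d] [c' d'].
  by rewrite !mem_filter /= => /andP[/eqP-> _] /andP[/eqP-> _] ->.
move=> b; rewrite mem_sliceY; apply/idP/mapP => [abP|[[c d]]].
  by exists (a, b); rewrite // mem_filter eqxx.
by rewrite mem_filter /= => /andP[/eqP-> cdP] ->.
Qed.

Lemma run_compute_projX : run (compute_projX P) = projX P.
Proof.
have H s X a : (a \in run (foldM (fun X (p : F * F) => insert F X p.1) X s)) =
    (a \in X) || (a \in [seq p.1 | p <- s]).
  elim: s X => [|p s IH] X /=; first by rewrite orbF.
  by rewrite IH !inE orbA [(a == _) || _]orbC.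
apply/fsetP => a; rewrite H inE /=; apply/mapP/projXP => [[[c d] cdP ->]|[b abP]].
  by exists d.
by exists (a, b).
Qed.

(** Processing a point changes only the entry of its own column. *)
Lemma run_compute_slices a :
  odflt fset0 (run (compute_slices P)).[? a] = sliceY P a.
Proof.
apply/fsetP => b; rewrite mem_sliceY /compute_slices.
suff H s (Y : {fmap F -> {fset F}}) :
    (b \in odflt fset0 (run (foldM (fun (Y : {fmap F -> {fset F}}) p =>
       let! S := get fset0 Y p.1 in
       let! S' := insert F S p.2 in
       put F Y p.1 S') Y s)).[? a]) =
    (b \in odflt fset0 Y.[? a]) || ((a, b) \in s).
  by rewrite H fnd_fmap0.
elim: s Y => [|[c d] s IH] Y; first by rewrite orbF.
rewrite [foldM _ _ _]/= /= IH fnd_set inE xpair_eqE.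
have [->|_] //= := eqVneq a c.
by rewrite !inE orbA [(b == _) || _]orbC.
Qed.

Lemma fnd_run_TreeVanish (S : {fset F}) (t : ptree F) :
    balanced_partition_tree S t ->
  {in nodes t, forall N, (run (TreeVanish sub t)).[? N] = Some (vanishing N)}.
Proof. by move=> tP N Nt; rewrite (TreeVanish_run subP tP) in_fnd ffunE. Qed.

Lemma run_compute_tree (S : {fset F}) :
  run (compute_tree sub S) = partition_tree sub S.
Proof. by rewrite run_bind. Qed.

Variable Fv : {ffun P -> F}.

Definition column_values a : {fmap F -> F} :=
  run (F := F) (table (sliceY P a) (fun b => get 0 (FinMap Fv) (a, b))).

Definition column_interp a : {poly F} :=
  run (UnivariateInterp sub (sliceY P a) (column_values a)).

Lemma column_interpP a :
  (size (column_interp a) <= #|` sliceY P a|)%N /\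
  forall b (abP : (a, b) \in P), (column_interp a).[b] = Fv [` abP].
Proof.
rewrite /column_interp /column_values run_table.
have [szf fE] := UnivariateInterp_run subP
  [ffun b : sliceY P a => run (F := F) (get 0 (FinMap Fv) (a, val b))].
split=> // b abP; have bS : b \in sliceY P a by rewrite mem_sliceY.
by rewrite (fE [` bS]) ffunE /= in_fnd.
Qed.

Lemma run_BivariateInterp : P != fset0 ->
  run (BivariateInterp sub Fv) =
  lagrange_comb (fun a => (vanishing (projX P `\ a)).[a]^-1 *: column_interp a)
                (projX P).
Proof.
move=> nzP; have [rootT balT] := partition_treeP subP (projX_neq0 nzP).
set T := partition_tree sub _ in rootT balT.
have UE := fnd_run_TreeVanish (conj rootT balT).
rewrite /BivariateInterp; do 9!(rewrite run_bind; cbv beta).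
rewrite run_compute_projX run_compute_tree run_poly_deriv -/T run_Combine // rootT.
apply: eq_lagrange_comb => a aX.
rewrite fnd_run_table aX /= run_poly_div_scalar fnd_run_table aX /=.
rewrite run_bind /= run_compute_slices.
rewrite (UnivariateMPE_run subP) in_fnd ffunE /=.
by rewrite UE -?rootT ?mem_tree_root //= rootT deriv_vanishing.
Qed.

Lemma size_BivariateInterp : P != fset0 ->
  (size (run (BivariateInterp sub Fv)) <= nX P)%N.
Proof. by move=> nzP; rewrite run_BivariateInterp // size_lagrange_comb. Qed.

Lemma sizeY_BivariateInterp : P != fset0 ->
  (sizeY (run (BivariateInterp sub Fv)) <= nuY P)%N.
Proof.
move=> nzP; rewrite run_BivariateInterp // sizeY_lagrange_comb // => a aX.
have [sza _] := column_interpP a.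
by rewrite (leq_trans (size_scale_leq _ _)) // (leq_trans sza) ?leq_nuY.
Qed.

Lemma interpolates_BivariateInterp : P != fset0 ->
  interpolates Fv (run (BivariateInterp sub Fv)).
Proof.
move=> nzP [[a b] abP] /=; have [_ fE] := column_interpP a.
rewrite run_BivariateInterp // horner_lagrange_comb ?(mem_projX abP) //.
rewrite scalerA mulfV ?vanishing_self_neq0 // scale1r fE.
by congr (Fv _); apply: val_inj.
Qed.

End Correctness.

(** * Uniqueness of the interpolant *)

Section Uniqueness.
Variables (M : nat -> nat) (sub : subroutines).
Hypothesis subP : subroutines_spec M sub.
Variables (F : finFieldType) (P : {fset F * F}).
Hypothesis nzP : P != fset0.

Lemma card_semi_grid : semi_grid P -> #|` P| = (nX P * nuY P)%N.
Proof.
move=> sg; rewrite -card_sum_sliceY /nX -sum1_size big_distrl /=.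
by apply: eq_big_seq => a aX; rewrite mul1n card_sliceY.
Qed.

Lemma interpolant_unique (Fv : {ffun P -> F}) (f g : {poly {poly F}}) :
    semi_grid P -> deg_bounded (nX P) (nuY P) f -> deg_bounded (nX P) (nuY P) g ->
    interpolates Fv f -> interpolates Fv g ->
  f = g.
Proof.
move=> sg fb gb fI gI; apply/eqP; rewrite -subr_eq0; apply/eqP.
have /andP[szX szY] : f - g \in @deg_bounded F (nX P) (nuY P) by rewrite rpredB.
apply: (bounded_interpolant_eq0 (card_sliceY sg)) => // a aX b.
rewrite mem_sliceY => abP; rewrite !hornerE.
by rewrite (fI [` abP]) (gI [` abP]) subrr.
Qed.

Lemma deg_bounded_BivariateInterp (Fv : {ffun P -> F}) :
  deg_bounded (nX P) (nuY P) (run (BivariateInterp sub Fv)).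
Proof.
by rewrite /deg_bounded (size_BivariateInterp subP) // (sizeY_BivariateInterp subP).
Qed.

Lemma BivariateInterpP (Fv : {ffun P -> F}) (f : {poly {poly F}}) :
    semi_grid P ->
  [/\ (size f <= nX P)%N, (sizeY f <= nuY P)%N & interpolates Fv f]
  <-> f = run (BivariateInterp sub Fv).
Proof.
move=> sg; split=> [[szX szY fI]|->].
  apply: (interpolant_unique sg _ _ fI); rewrite ?deg_bounded_BivariateInterp //.
    by rewrite /deg_bounded szX.
  exact: (interpolates_BivariateInterp subP).
have /andP[szX szY] := deg_bounded_BivariateInterp Fv.
by split=> //; apply: (interpolates_BivariateInterp subP).
Qed.

Definition interp_bipoly (Fv : {ffun P -> F}) : bipoly F (nX P) (nuY P) :=
  BiPoly (deg_bounded_BivariateInterp Fv).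

Lemma interp_bipoly_bij : semi_grid P -> bijective interp_bipoly.
Proof.
move=> sg; exists (fun f : bipoly F (nX P) (nuY P) =>
  [ffun p : P => (bipoly_val f).[(val p).1, (val p).2]]) => [Fv|f].
  by apply/ffunP => p; rewrite ffunE (interpolates_BivariateInterp subP).
apply: val_inj; apply/esym/BivariateInterpP => //=.
have /andP[szX szY] := bipolyP f; split=> // p.
by rewrite ffunE.
Qed.

(** A column [a] with fewer than [nuY P] points leaves room for the product of
    the lines [X = c] through the other columns and the lines [Y = b] through
    the points of column [a]; it vanishes on [P] and may be added to any
    interpolant. *)
Lemma vanishing_bipoly a : a \in projX P -> (#|` sliceY P a| < nuY P)%N ->
  exists2 g : {poly {poly F}}, g != 0 &
    deg_bounded (nX P) (nuY P) g /\ forall p : P, g.[(val p).1, (val p).2] = 0.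
Proof.
move=> aX lt_a.
exists ((vanishing (projX P `\ a))^:P * (vanishing (sliceY P a))%:P).
  by rewrite mulf_neq0 ?polyC_eq0 ?vanishing_neq0 // -size_poly_eq0
    size_map_polyC size_vanishing.
split.
  rewrite /deg_bounded sizeYE rmorphM /= swapXY_map_polyC swapXY_polyC.
  rewrite mulrC !mul_polyC; apply/andP; split;
    rewrite (leq_trans (size_scale_leq _ _)) // size_map_polyC size_vanishing //.
  by rewrite cardfsD1_pred.
case=> -[c d] /= cdP; rewrite !hornerE horner_map /= hornerC.
have [eq_ca|ne_ca] := eqVneq c a.
  have /rootP -> : root (vanishing (sliceY P a)) d.
    by rewrite root_vanishing mem_sliceY -eq_ca.
  by rewrite mulr0.
have /rootP -> : root (vanishing (projX P `\ a)) c.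
  by rewrite root_vanishing !inE ne_ca (mem_projX cdP).
by rewrite mul0r.
Qed.

Lemma not_semi_grid_short_column : ~ semi_grid P ->
  exists2 a, a \in projX P & (#|` sliceY P a| < nuY P)%N.
Proof.
move=> nsg.
have [/existsP[a /andP[aX lt_a]]|no] := boolP
    [exists a, (a \in projX P) && (#|` sliceY P a| < nuY P)%N]; first by exists a.
case: nsg => a; have [aX|] := boolP (a \in projX P); last first.
  by rewrite -sliceY_eq0 => /eqP->; left; rewrite cardfs0.
right; apply/eqP; rewrite eqn_leq leq_nuY // leqNgt.
by move: no; rewrite negb_exists => /forallP /(_ a); rewrite aX.
Qed.

Lemma interpolant_not_unique (Fv : {ffun P -> F}) : ~ semi_grid P ->
  exists2 f : {poly {poly F}}, f <> run (BivariateInterp sub Fv) &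
    [/\ (size f <= nX P)%N, (sizeY f <= nuY P)%N & interpolates Fv f].
Proof.
case/not_semi_grid_short_column => a aX lt_a.
have [g nzg [gb g0]] := vanishing_bipoly aX lt_a.
set f := run _; exists (f + g).
  by move/eqP; rewrite -subr_eq0 addrC addKr (negPf nzg).
have /andP[szX szY] : f + g \in @deg_bounded F (nX P) (nuY P).
  by rewrite rpredD //; apply: deg_bounded_BivariateInterp.
split=> // p; rewrite !hornerD g0 addr0.
exact: (interpolates_BivariateInterp subP).
Qed.

End Uniqueness.

Lemma dim_bipoly (F : fieldType) m n : \dim {: bipoly F m n} = (m * n)%N.
Proof. exact: dimvf. Qed.

Lemma dim_values (F : fieldType) (I : choiceType) (P : {fset I}) :
  \dim {: {ffun P -> F^o}} = #|` P|.
Proof. by rewrite dimvf /dim /= -cardfE muln1. Qed.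

(** * Quasi-linear growth *)

Section Growth.
Local Open Scope nat_scope.

(** Unlike the two O-classes it stands for, this bound holds for every positive
    size and has no value 0 at size 1, so that bounds for the pieces of an input
    add up. *)
Definition soft_below (c K : nat) (f : nat -> nat) : Prop :=
  forall n, 0 < n -> f n <= K * (n * (log n).+1 ^ c).

Lemma log_mono : {homo log : m n / m <= n}.
Proof. exact: leq_trunc_log. Qed.

(** The finitely many sizes below the threshold are absorbed into the constant;
    the successor covers those where [g] vanishes. *)
Lemma bigO_everywhere f g : bigO f g -> exists K, forall n, f n <= K * (g n).+1.
Proof.
case=> C [n0 le_f]; exists (C + \max_(i < n0) f i) => n.
have [/le_f le_n|lt_n] := leqP n0 n.
  by rewrite (leq_trans le_n) // leq_mul ?leq_addr.
have le_n := leq_bigmax (F := fun i : 'I_n0 => f i) (Ordinal lt_n).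
by rewrite (leq_trans le_n) // mulnS -addnA addnCA leq_addr.
Qed.

Lemma soft_belowW c K c' K' f : c <= c' -> K <= K' ->
  soft_below c K f -> soft_below c' K' f.
Proof.
move=> le_c le_K fb n n_gt0; apply: leq_trans (fb n n_gt0) _.
by rewrite !leq_mul // leq_pexp2l.
Qed.

Lemma leq_exp2rW m n e : m <= n -> m ^ e <= n ^ e.
Proof. by case: e => // e le_mn; rewrite leq_exp2r. Qed.

Lemma quasi_linear_soft_below f : quasi_linear f ->
  exists c K, soft_below c K f.
Proof.
case=> c /bigO_everywhere[K le_f]; exists c, (K * 2) => n n_gt0.
apply: leq_trans (le_f n) _; rewrite -mulnA leq_mul // mul2n -addnn -add1n.
rewrite leq_add ?muln_gt0 ?n_gt0 ?expn_gt0 //.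
by rewrite leq_mul // leq_exp2rW.
Qed.

Lemma soft_below_bigO c K M W : soft_below c K M ->
  bigO W (fun n => M n * log n) -> exists K', soft_below c.+1 K' W.
Proof.
move=> Mb /bigO_everywhere[K0 le_W]; exists (K0 * K.+1) => n n_gt0.
apply: leq_trans (le_W n) _; rewrite -mulnA leq_mul //.
set l := (log n).+1; have l_gt0 : 0 < n * l ^ c.+1 by rewrite muln_gt0 n_gt0 expn_gt0.
rewrite mulSn -add1n leq_add // expnSr [n * _]mulnA mulnA.
by rewrite leq_mul // Mb.
Qed.

Lemma soft_below_quasi_linear c K : quasi_linear (fun n => K * (n * (log n).+1 ^ c)).
Proof.
exists c, (K * 2 ^ c), 2 => n n_gt1.
have log_gt0 : 0 < log n by rewrite /log trunc_log_gt0.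
rewrite -!mulnA leq_mul // mulnCA leq_mul // -expnMn leq_exp2rW //.
by rewrite mul2n -addnn -add1n leq_add2r.
Qed.

End Growth.

(** * The cost of the algorithm *)

Section TreeWeight.
Local Open Scope nat_scope.

(** Writing the tree down and [Combine] are both bounded, at each node, by a
    common multiple of its size; the sum of the sizes of all subtrees measures
    both. *)
Fixpoint tree_weight (K : choiceType) (t : ptree K) : nat :=
  match t with
  | Leaf _ => 1
  | Node l r => #|` tree_root t| + (tree_weight l + tree_weight r)
  end.

Lemma card_tree_root_gt0 (K : choiceType) (t : ptree K) : 0 < #|` tree_root t|.
Proof.
elim: t => [a|l IHl r _] /=; first by rewrite cardfs1.
by apply: leq_trans IHl _; rewrite fsubset_leq_card ?fsubsetUl.
Qed.

Lemma card_fsetU_disjoint (K : choiceType) (A B : {fset K}) : [disjoint A & B]%fset ->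
  #|` (A `|` B)%fset| = #|` A| + #|` B|.
Proof. by move=> dis; rewrite (perm_size (perm_fsetU dis)) size_cat. Qed.

(** Balance halves the size, rounded up, from one level to the next. *)
Lemma tree_weight_le (K : choiceType) (t : ptree K) : balanced t ->
  tree_weight t <= #|` tree_root t| * (up_log 2 #|` tree_root t|).+1.
Proof.
elim: t => [a|l IHl r IHr] /=; first by rewrite cardfs1 up_log1.
case/and5P=> dis le_lr le_rl /IHl{}IHl /IHr{}IHr; rewrite card_fsetU_disjoint //.
have l_gt0 := card_tree_root_gt0 l; have r_gt0 := card_tree_root_gt0 r.
move: #|` tree_root l| #|` tree_root r| le_lr le_rl l_gt0 r_gt0 IHl IHr
  => p q le_pq le_qp p_gt0 q_gt0 wl wr.
(* This is half of the size, rounded up. *)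
set k := (p + q).-1./2.+1.
have upE : up_log 2 (p + q) = (up_log 2 k).+1.
  by rewrite -up_log2S ?prednK //; lia.
have le_p : up_log 2 p <= up_log 2 k by apply: leq_up_log; rewrite /k; lia.
have le_q : up_log 2 q <= up_log 2 k by apply: leq_up_log; rewrite /k; lia.
rewrite upE mulnS leq_add2l mulnDl leq_add //.
  by apply: leq_trans wl _; rewrite leq_mul.
by apply: leq_trans wr _; rewrite leq_mul.
Qed.

Lemma up_log_le_log n : up_log 2 n <= (log n).+1.
Proof. by apply: up_log_min => //; apply/ltnW/trunc_log_ltn. Qed.

(** Writing the tree down costs the left-hand side. *)
Lemma sum_nodes_le_weight (K : choiceType) (t : ptree K) :
  \sum_(N <- nodes t) #|` N| <= tree_weight t.
Proof.
have sumU (A B : {fset {fset K}}) : \sum_(N <- (A `|` B)%fset) #|` N| <=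
    \sum_(N <- A) #|` N| + \sum_(N <- B) #|` N|.
  rewrite -big_cat; apply: sub_le_big_seq => // [m n|N]; first exact: leq_addr.
  rewrite count_cat !count_uniq_mem ?fset_uniq // inE.
  by case: (N \in A); case: (N \in B).
elim: t => [a|l IHl r IHr] /=; first by rewrite big_seq_fset1 cardfs1.
apply: leq_trans (sumU _ _) _; rewrite big_seq_fset1 leq_add2l.
exact: leq_trans (sumU _ _) (leq_add IHl IHr).
Qed.

End TreeWeight.

Section Complexity.
Local Open Scope nat_scope.
Variables (M : nat -> nat) (sub : subroutines).
Hypothesis subP : subroutines_spec M sub.
Variable F : finFieldType.

Lemma sum_fset_const (K : choiceType) (S : {fset K}) k :
  \sum_(a <- S) k = #|` S| * k.
Proof. by rewrite big_const_seq count_predT iter_addn_0 mulnC. Qed.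

Lemma cost_table_get (K : choiceType) (B : Type) (d : B) (S : {fset K})
    (T : {fmap K -> B}) :
  cost (@table F K B S (get d T)) = #|` S| * 2.
Proof. by rewrite cost_table /= sum_fset_const. Qed.

(** At a node of size [s] the two products in [F[X]] for each of the at most [v]
    powers of [Y] have degree at most [s], and the addition touches [s * v]
    coefficients. *)
Lemma cost_Combine (t : ptree F) (V : {fmap F -> {poly F}})
    (U : {fmap {fset F} -> {poly F}}) v B :
    balanced t -> {in nodes t, forall N, (U.[? N])%fmap = Some (vanishing N)} ->
    {in tree_root t, forall a, size (odflt 0%R V.[? a]%fmap) <= v} ->
    (forall m, 0 < m <= #|` tree_root t| -> M m <= m * B) ->
  cost (Combine sub t V U) <= tree_weight t * (5 + v * (1 + 2 * B)).
Proof.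
elim: t V => [a|l IHl r IHr] V //= => /and5P[dis _ _ ball balr] UE Vv MB.
have Ul : {in nodes l, forall N, (U.[? N])%fmap = Some (vanishing N)}.
  by move=> N Nl; apply: UE; rewrite !inE Nl !orbT.
have Ur : {in nodes r, forall N, (U.[? N])%fmap = Some (vanishing N)}.
  by move=> N Nr; apply: UE; rewrite !inE Nr !orbT.
pose Vl := run (F := F) (table (tree_root l) (get 0%R V)).
pose Vr := run (F := F) (table (tree_root r) (get 0%R V)).
have Vlv : {in tree_root l, forall a, size (odflt 0%R Vl.[? a]%fmap) <= v}.
  by move=> a al; rewrite fnd_run_table al Vv // inE al.
have Vrv : {in tree_root r, forall a, size (odflt 0%R Vr.[? a]%fmap) <= v}.
  by move=> a ar; rewrite fnd_run_table ar Vv // inE ar orbT.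
do 4!(rewrite cost_bind; cbv beta).
rewrite /= !(cost_bind (bipoly_mulX _ _ _)).
rewrite -/Vl -/Vr !cost_table_get !(run_bipoly_mulX subP) !(run_Combine subP) //.
rewrite (Ul _ (mem_tree_root l)) (Ur _ (mem_tree_root r)) /=.
move: MB {UE Vv}; rewrite card_fsetU_disjoint //.
have l_gt0 := card_tree_root_gt0 l; have r_gt0 := card_tree_root_gt0 r.
have szl := size_lagrange_comb (fun a => odflt 0%R Vl.[? a]%fmap) (tree_root l).
have szr := size_lagrange_comb (fun a => odflt 0%R Vr.[? a]%fmap) (tree_root r).
have szYl := sizeY_lagrange_comb Vlv; have szYr := sizeY_lagrange_comb Vrv.
set fl := lagrange_comb _ _ in szl szYl *; set fr := lagrange_comb _ _ in szr szYr *.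
have szul := size_vanishing (tree_root l); have szur := size_vanishing (tree_root r).
move=> MB.
have cl : cost (Combine sub l Vl U) <= tree_weight l * (5 + v * (1 + 2 * B)).
  by apply: IHl => // m /andP[m_gt0 le_m]; rewrite MB // m_gt0 (leq_trans le_m) ?leq_addr.
have cr : cost (Combine sub r Vr U) <= tree_weight r * (5 + v * (1 + 2 * B)).
  by apply: IHr => // m /andP[m_gt0 le_m]; rewrite MB // m_gt0 (leq_trans le_m) ?leq_addl.
move: cl cr szl szr szul szur l_gt0 r_gt0 MB.
set p := #|` tree_root l|; set q := #|` tree_root r|.
move=> cl cr szl szr szul szur p_gt0 q_gt0 MB.
have {}MB : M (p + q) <= (p + q) * B by rewrite MB //; lia.
have c1 : cost (bipoly_mulX sub fl (vanishing (tree_root r))) <= v * M (p + q).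
  apply: (cost_bipoly_mulX subP) => //.
    by apply: leq_trans szl _; lia.
  by apply: leq_trans (eq_leq szur) _; lia.
have c2 : cost (bipoly_mulX sub fr (vanishing (tree_root l))) <= v * M (p + q).
  apply: (cost_bipoly_mulX subP) => //.
    by apply: leq_trans szr _; lia.
  by apply: leq_trans (eq_leq szul) _; lia.
have szM (f : {poly {poly F}}) S : size f + #|` S| <= p + q ->
    size (f * (vanishing S)^:P)%R <= p + q.
  move=> le_f; apply: leq_trans (size_polyMleq _ _) _.
  by rewrite size_map_polyC size_vanishing addnS.
have szYM (f : {poly {poly F}}) S : sizeY f <= v ->
    sizeY (f * (vanishing S)^:P)%R <= v.
  rewrite !sizeYE rmorphM /= swapXY_map_polyC mulrC mul_polyC.
  exact: leq_trans (size_scale_leq _ _).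
have c3 : cost (bipoly_add (fl * (vanishing (tree_root r))^:P)%R
                           (fr * (vanishing (tree_root l))^:P)%R) <= (p + q) * v.
  apply: cost_bipoly_add; rewrite ?szYM //; apply: szM; first exact: leq_add.
  by rewrite addnC leq_add.
have vM : v * M (p + q) <= v * ((p + q) * B) by rewrite leq_mul.
rewrite -/p -/q in c1 c2 c3 *.
move: (cost (Combine sub l Vl U)) (cost (Combine sub r Vr U)) cl cr => kl kr.
move: (cost (bipoly_mulX _ _ _)) c1 => k1.
move: (cost (bipoly_mulX _ _ _)) c2 => k2.
move: (cost (bipoly_add _ _)) c3 => k3.
have -> : (p + q + (tree_weight l + tree_weight r)) * (5 + v * (1 + 2 * B)) =
    (p + q) * 5 + (p + q) * v + 2 * (v * ((p + q) * B)) +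
    tree_weight l * (5 + v * (1 + 2 * B)) + tree_weight r * (5 + v * (1 + 2 * B)).
  by lia.
lia.
Qed.

Lemma cost_compute_projX (P : {fset F * F}) : cost (compute_projX P) = #|` P|.
Proof. by rewrite (cost_foldM_const (c := 1)) // mul1n. Qed.

Lemma cost_compute_slices (P : {fset F * F}) :
  cost (compute_slices P) = 3 * #|` P|.
Proof. exact: (cost_foldM_const (c := 3)). Qed.

Lemma cost_compute_tree (S : {fset F}) :
  cost (compute_tree sub S) =
  \sum_(N <- nodes (partition_tree sub S)) #|` N|.
Proof. by rewrite cost_bind cost_accesses addn0. Qed.

Variables (c K : nat) (WE WI WT : nat -> nat).
Hypothesis Mb : soft_below c K M.
Hypothesis WEb : soft_below c K WE.
Hypothesis WIb : soft_below c K WI.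
Hypothesis WTb : soft_below c K WT.
Hypothesis MPE_cost : forall (h : {poly F}) (S : {fset F}),
  cost (UnivariateMPE sub h S) <= WE ((size h).-1 + #|` S|).
Hypothesis Interp_cost : forall (S : {fset F}) (V : {ffun S -> F}),
  cost (UnivariateInterp sub S (FinMap V)) <= WI #|` S|.
Hypothesis TreeVanish_cost : forall (S : {fset F}) (t : ptree F),
  balanced_partition_tree S t -> cost (TreeVanish sub t) <= WT #|` S|.

(** The semi-grid condition enters through [#|` P| = nX P * nuY P]: the [nX P]
    column interpolations have size exactly [nuY P], and the products in
    [Combine], of degree at most [nX P], are needed for at most [nuY P] powers of
    [Y]. The extra logarithm is the depth of the tree. Multipoint evaluation
    runs at size up to [2 * nX P], which doubles the size and at most doubles the
    logarithm: hence the factor [2 ^ c.+1]. *)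
Lemma cost_BivariateInterp_le (P : {fset F * F}) (Fv : {ffun P -> F}) :
    P != fset0%fset -> semi_grid P ->
  cost (BivariateInterp sub Fv) <=
  (29 + K * (6 + 2 ^ c.+1)) * (#|` P| * (log #|` P|).+1 ^ c.+1).
Proof.
move=> nzP sg; have nzX := projX_neq0 nzP.
have [rootT balT] := partition_treeP subP nzX.
set T := partition_tree sub _ in rootT balT.
have UE := fnd_run_TreeVanish subP (conj rootT balT).
rewrite /BivariateInterp; do 4!(rewrite cost_bind; cbv beta).
rewrite cost_compute_tree; do 3!(rewrite cost_bind; cbv beta).
rewrite cost_poly_deriv; do 2!(rewrite cost_bind; cbv beta).
rewrite run_compute_projX run_compute_tree run_poly_deriv -/T.
rewrite cost_compute_projX cost_compute_slices !cost_table.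
have uE : run (F := F) (get 0%R (run (TreeVanish sub T)) (projX P)) = vanishing (projX P).
  by rewrite /= UE // -rootT mem_tree_root.
rewrite !uE size_vanishing /=.
set fhat := run (table (projX P) _); set R := run (UnivariateMPE sub _ _).
set V := run (table (projX P) _).
set X := projX P in fhat R V *; set n := #|` P|; set v := nuY P.
have nE : n = #|` X| * v by apply: card_semi_grid.
have X_gt0 : 0 < #|` X| by rewrite cardfs_gt0.
have n_gt0 : 0 < n by rewrite cardfs_gt0.
have v_gt0 : 0 < v by move: n_gt0; rewrite nE muln_gt0 => /andP[].
have sizev a : a \in X -> size (odflt 0%R fhat.[? a]%fmap) <= v.
  move=> aX; rewrite fnd_run_table aX /= run_bind run_compute_slices.
  by have [/leq_trans-> //] := column_interpP subP Fv a; rewrite leq_nuY.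
have bound f m : soft_below c K f -> 0 < m <= n -> f m <= m * (K * (log n).+1 ^ c).
  move=> fb /andP[m_gt0 le_mn]; apply: leq_trans (fb m m_gt0) _.
  by rewrite mulnCA !leq_mul // leq_exp2rW // ltnS log_mono.
have le_Xn : #|` X| <= n by rewrite nE leq_pmulr.
have le_vn : v <= n by rewrite nE leq_pmull.
set g := (log n).+1 in bound *; set B := K * g ^ c in bound *.
have weight_le : tree_weight T <= #|` X| * (2 * g).
  apply: leq_trans (tree_weight_le balT) _; rewrite rootT leq_mul2l.
  have := up_log_le_log #|` X|; have := log_mono le_Xn; rewrite /g -/X; lia.
have columns_le : \sum_(a <- X) (cost (let! Fa := table
      (odflt fset0 (run (F := F) (compute_slices P)).[? a]%fmap)
      (fun b : F => get 0%R (FinMap Fv) (a, b)) in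
    UnivariateInterp sub
      (odflt fset0 (run (F := F) (compute_slices P)).[? a]%fmap) Fa)).+2
    <= #|` X| * (2 + v * 2 + v * B).
  rewrite -sum_fset_const big_seq [leqRHS]big_seq; apply: leq_sum => a aX.
  rewrite run_compute_slices cost_bind cost_table /= sum_fset_const run_table.
  rewrite card_sliceY // -/v -2!addSn leq_add2l.
  apply: leq_trans (Interp_cost _) _; rewrite card_sliceY // bound //.
  by rewrite v_gt0.
have divisions_le : \sum_(a <- X) (cost (poly_div_scalar (odflt 0%R fhat.[? a]%fmap)
    (odflt 0%R R.[? a]%fmap))).+3 <= #|` X| * (3 + v).
  rewrite -sum_fset_const big_seq [leqRHS]big_seq; apply: leq_sum => a aX.
  by rewrite cost_poly_div_scalar -[(_).+3]/(3 + _) leq_add2l sizev.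
have vanish_le : cost (TreeVanish sub T) <= #|` X| * B.
  apply: leq_trans (TreeVanish_cost (conj rootT balT)) _.
  by rewrite bound // X_gt0.
have mpe_le : cost (UnivariateMPE sub (vanishing X)^`() X) <=
    #|` X| * (2 ^ c.+1 * B).
  apply: leq_trans (MPE_cost _ _) _; set m := _ + _.
  have le_m : m <= 2 * #|` X|.
    rewrite mul2n -addnn leq_add2r.
    have := lt_size_deriv (vanishing_neq0 X); rewrite size_vanishing ltnS.
    exact/leq_trans/leq_pred.
  have m_gt0 : 0 < m by rewrite (leq_trans X_gt0) ?leq_addl.
  apply: leq_trans (WEb m_gt0) _.
  have le_log : (log m).+1 <= 2 * g.
    have := log_mono le_m; rewrite mul2n /log trunc_log2_double // => le_l.
    by have := log_mono le_Xn; rewrite /g /log in le_l *; lia.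
  apply: (@leq_trans (K * (2 * #|` X| * (2 * g) ^ c))).
    by rewrite !leq_mul // leq_exp2rW.
  by rewrite expnMn expnS /B; lia.
have combine_le : cost (Combine sub T V (run (TreeVanish sub T))) <=
    #|` X| * (2 * g) * (5 + v * (1 + 2 * B)).
  apply: leq_trans (leq_mul weight_le (leqnn _)).
  apply: (cost_Combine balT UE) => [a|m]; rewrite rootT -/X; last first.
    by move=> /andP[m_gt0 le_m]; rewrite bound // m_gt0 (leq_trans le_m).
  move=> aX; rewrite fnd_run_table aX /= run_poly_div_scalar.
  by rewrite (leq_trans (size_scale_leq _ _)) ?sizev.
have writing_le := leq_trans (sum_nodes_le_weight T) weight_le.
set D := 2 ^ c.+1 in mpe_le *.
(* One term for each step of the algorithm, in order. *)
apply: (@leq_trans (n + (3 * n + (#|` X| * (2 + v * 2 + v * B) +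
    (#|` X| * (2 * g) + (#|` X| * B + (1 + (#|` X|.*2 + (#|` X| * (D * B) +
    (#|` X| * (3 + v) + #|` X| * (2 * g) * (5 + v * (1 + 2 * B)))))))))))).
  by rewrite !leq_add.
rewrite expnS /B; have : 0 < g ^ c by rewrite expn_gt0.
have : 0 < g by []; move: le_Xn X_gt0 n_gt0; rewrite nE.
move: (D) #|` X| (g) (g ^ c) => d x h u le_x x_gt0 n_gt0 h_gt0 u_gt0.
(* Every term of the bound is dominated by one of N, K * N and d * (K * N). *)
set N := x * v * (h * u).
have N_x : x <= N by rewrite (leq_trans le_x) // leq_pmulr // muln_gt0 h_gt0.
have N_n : x * v <= N by rewrite leq_pmulr // muln_gt0 h_gt0.
have N_nh : x * v * h <= N by rewrite /N mulnA leq_pmulr.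
have N_xh : x * h <= N by rewrite (leq_trans _ N_nh) // leq_mul.
have N_nu : x * v * u <= N by rewrite /N mulnCA leq_pmull.
have N_xu : x * u <= N by rewrite (leq_trans _ N_nu) // leq_mul.
have K_nu : K * (x * v * u) <= K * N by rewrite leq_mul.
have K_xu : K * (x * u) <= K * N by rewrite leq_mul.
have K_d : d * (K * (x * u)) <= d * (K * N) by rewrite leq_mul.
have K_nhu : K * (x * v * h * u) = K * N by rewrite /N; lia.
have -> : (29 + K * (6 + d)) * N = 29 * N + 6 * (K * N) + d * (K * N) by lia.
by lia.
Qed.

End Complexity.

(** Each subroutine bound [M n * log n] adds one to the exponent of [M]; one
    constant, the sum of the individual ones, then serves for all. *)
Lemma BivariateInterp_quasi_linear (M : nat -> nat) (sub : subroutines) :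
    quasi_linear M -> subroutines_spec M sub ->
  exists2 W : nat -> nat, quasi_linear W &
    forall (F : finFieldType) (P : {fset F * F}) (Fv : {ffun P -> F}),
      P != fset0 -> semi_grid P ->
      (cost (BivariateInterp sub Fv) <= W #|` P |)%N.
Proof.
case/quasi_linear_soft_below => c [K0 Mb] subP.
have [WE /(soft_below_bigO Mb)[K1 WEb] costE] := UnivariateMPE_cost subP.
have [WI /(soft_below_bigO Mb)[K2 WIb] costI] := UnivariateInterp_cost subP.
have [WT /(soft_below_bigO Mb)[K3 WTb] costT] := TreeVanish_cost subP.
pose K := (K0 + K1 + K2 + K3)%N.
exists (fun n => (29 + K * (6 + 2 ^ c.+2)) * (n * (log n).+1 ^ c.+2))%N.
  exact: soft_below_quasi_linear.
move=> F P Fv nzP sg.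
apply: (@cost_BivariateInterp_le M sub subP F c.+1 K WE WI WT) => //.
- by apply: soft_belowW Mb => //; rewrite /K; lia.
- by apply: soft_belowW WEb => //; rewrite /K; lia.
- by apply: soft_belowW WIb => //; rewrite /K; lia.
- by apply: soft_belowW WTb => //; rewrite /K; lia.
- exact: costT.
Qed.

Theorem mainTheorem7 (M : nat -> nat) (sub : subroutines) :
  quasi_linear M -> subroutines_spec M sub ->
  [/\ exists2 W : nat -> nat, quasi_linear W &
        forall (F : finFieldType) (P : {fset F * F}) (Fv : {ffun P -> F}),
          P != fset0 -> semi_grid P ->
          (cost (BivariateInterp sub Fv) <= W #|` P |)%N,
      forall (F : finFieldType) (P : {fset F * F}),
        P != fset0 -> semi_grid P ->
        [/\ forall Fv : {ffun P -> F},
              let f := run (BivariateInterp sub Fv) in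
              (size f <= nX P)%N /\ (sizeY f <= nuY P)%N,
            [/\ \dim {: bipoly F (nX P) (nuY P)} = (nX P * nuY P)%N,
                \dim {: {ffun P -> F^o}} = #|` P | &
                exists2 phi : {ffun P -> F} -> bipoly F (nX P) (nuY P),
                  bijective phi &
                  forall Fv, phi Fv = run (BivariateInterp sub Fv)
                    :> {poly {poly F}}] &
            forall (Fv : {ffun P -> F}) (f : {poly {poly F}}),
              [/\ (size f <= nX P)%N, (sizeY f <= nuY P)%N &
                  interpolates Fv f]
              <-> f = run (BivariateInterp sub Fv)] &
      forall (F : finFieldType) (P : {fset F * F}) (Fv : {ffun P -> F}),
        P != fset0 -> ~ semi_grid P ->
        exists2 f : {poly {poly F}}, f <> run (BivariateInterp sub Fv) &
          [/\ (size f <= nX P)%N, (sizeY f <= nuY P)%N & interpolates Fv f]].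
Proof.
move=> qM subP; split; first exact: BivariateInterp_quasi_linear qM subP.
- move=> F P nzP sg; split=> [Fv||Fv f]; last exact: (BivariateInterpP subP).
    by have /andP[] := deg_bounded_BivariateInterp subP nzP Fv.
  split; [exact: dim_bipoly | exact: dim_values |].
  exists (interp_bipoly subP nzP); first exact: interp_bipoly_bij.
  by [].
- by move=> F P Fv nzP; apply: (interpolant_not_unique subP).
Qed.
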